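(* Let $(\mathcal U_1,U_1,V_1)$ be a metric $f$-structure and $(\mathcal U_2,U_2,V_2,W_2,Z_2)$ a dual system of metric $f$-structures. Let $\phi\colon(\mathcal U_1,U_1,V_1)\to(\mathcal U_2,U_2,V_2)$ be a homomorphism of metric $f$-structures. Let $\mathscr M$ be a $V_1$-normed $U_1$-module and $\mathscr N$ a $Z_2$-Banach $U_2$-module. Let $\mathscr V$ be a vector subspace of $\mathscr M$ such that $\mathscr G(\mathscr V)$ is dense in $\mathscr M$. Let $T\colon\mathscr V\to\mathscr N$ be linear and such that for some $b\in W_2^+$ it holds $$|Tv|\le b\,\phi(|v|)\quad\text{for every }v\in\mathscr V.$$ Then there exists a unique linear operator $\bar T\colon\mathscr M\to\mathscr N$ such that $\bar T|_{\mathscr V}=T$ and $|\bar Tv|\le b\,\phi(|v|)$ for every $v\in\mathscr M$. In particular, $\bar T$ is continuous. Moreover, $$\bar T(u\cdot v)=\phi(u)\cdot\bar T(v)\quad\text{for every }u\in U_1\text{ and }v\in\mathscr M.$$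
   Context: Riesz spaces and $f$-algebras. $\mathbb R^+=[0,\infty)$. A Riesz space is a real vector space $U$ with a partial order that is a lattice and satisfies $u\le v\Rightarrow u+w\le v+w$ and ($u\ge 0$, $\lambda\in\mathbb R^+$) $\Rightarrow\lambda u\ge 0$; $\vee,\wedge$ denote sup and inf of two elements, $u^{+}=u\vee 0$, $u^-=(-u)\vee 0$, $|u|=u\vee(-u)$, $U^+=\{u\in U:u\ge 0\}$. A Riesz subspace is a linear subspace closed under $\vee,\wedge$; a Riesz subspace $V\subset U$ is solid if $v\in U$, $u\in V$, $|v|\le|u|$ imply $v\in V$. A homomorphism of Riesz spaces is a linear map $\phi$ with $\phi(u)\wedge\phi(v)=0$ whenever $u\wedge v=0$. A family is disjoint if $|u|\wedge|v|=0$ for any two different members. Dedekind $\sigma$-complete: every countable non-empty subset bounded above has a supremum and every countable non-empty subset bounded below has an infimum. An $f$-algebra is a Riesz space with an associative, commutative, $\mathbb R$-bilinear multiplication with unit $\mathbf 1_U$ such that $uv\ge0$ for $u,v\ge 0$, and $(uw)\wedge v=0$ whenever $u\wedge v=0$ and $w\ge 0$. An $f$-subalgebra is a Riesz subspace closed under multiplication and containing $\mathbf 1_U$. A homomorphism of $f$-algebras is a multiplicative, unit-preserving homomorphism of Riesz spaces. $\mathrm{Idem}(U)=\{u\in U:u^2=u\}$. A finite partition of $u\in\mathrm{Idem}(U)$ is a finite disjoint family in $\mathrm{Idem}(U)$ with sum $u$; a countable partition of $u$ is a disjoint family $(u_n)_{n\in\mathbb N}\subset\mathrm{Idem}(U)$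 with $\sup_n u_n=u$; $\mathcal P(u)$ is the set of countable partitions of $u$. Simple elements: $\mathcal S(U)=\{\sum_{i=1}^n\lambda_iu_i:\lambda_i\in\mathbb R,\ (u_i)_{i=1}^n\text{ a finite partition of }\mathbf 1_U\}$. An order-preserving map is $\sigma$-order-continuous if it preserves existing suprema of non-decreasing sequences and existing infima of non-increasing sequences. A localisable $f$-algebra is a Dedekind $\sigma$-complete $f$-algebra whose multiplication is $\sigma$-order-continuous on $U^+\times U^+$ and such that every $u\in U^+$ is the supremum of a non-decreasing sequence in $\mathcal S(U)\cap U^+$. Metric notions (products of metric spaces carry the sum distance). A metric Riesz space $(U,\mathsf d_U)$ is a Dedekind $\sigma$-complete Riesz space with a complete distance such that $\mathsf d_U(u,0)=\mathsf d_U(|u|,0)$, $\mathsf d_U(u+w,v+w)=\mathsf d_U(u,v)$, and $\mathsf d_U(u,0)\le\mathsf d_U(v,0)$ whenever $0\le u\le v$. A metric $f$-algebra is a localisable $f$-algebra $U$ with a distance $\mathsf d_U$ such that $(U,\mathsf d_U)$ is a metric Riesz space, the multiplication $U\times U\to U$ is continuous, $\mathcal S(U)$ is dense, and $\mathsf d_U(\varepsilon\mathbf 1_U,0)\to0$ as $\varepsilon\searrow0$. A metric $f$-structure is a triple $(\mathcal U,U,V)$ where $\mathcal U$ is a localisable $f$-algebra; $(U,\mathsf d_U)$ is a metric $f$-algebra that is a solid $f$-subalgebra of $\mathcal U$; $(V,\mathsf d_V)$ is a metric Riesz space that is a solid Riesz subspace of $\mathcal U$; $UV=V$ (where $UV=\{uv:u\in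 U,v\in V\}$) and the multiplication $U\times V\to V$ is continuous; and for any $(u_n)_n\in\mathcal P(\mathbf 1_U)$ and $\varepsilon>0$ there is $\delta>0$ such that, whenever $(v_n)_n\subset V^+$ satisfies $\sum_n\mathsf d_V(u_nv_n,0)\le\delta$, the family $(u_nv_n)_n$ is order-bounded in $V$ and $\mathsf d_V(\sup_nu_nv_n,0)\le\varepsilon$. A homomorphism of metric $f$-structures $(\mathcal U_1,U_1,V_1)\to(\mathcal U_2,U_2,V_2)$ is a homomorphism of $f$-algebras $\phi\colon\mathcal U_1\to\mathcal U_2$ such that $\phi|_{U_1}\colon U_1\to U_2$ is a Lipschitz, $\sigma$-order-continuous homomorphism of $f$-algebras and $\phi|_{V_1}\colon V_1\to V_2$ is a Lipschitz homomorphism of Riesz spaces. A dual system of metric $f$-structures is a quintuplet $(\mathcal U,U,V,W,Z)$ such that $(\mathcal U,U,V)$, $(\mathcal U,U,W)$, $(\mathcal U,U,Z)$ are metric $f$-structures, $Z=VW$ and the multiplication $V\times W\to Z$ is continuous. Modules. A $V$-normed $U$-module over a metric $f$-structure $(\mathcal U,U,V)$ is a $U$-module $\mathscr M$ (a real vector space via $\lambda v=(\lambda\mathbf 1_U)\cdot v$) with a map $|\cdot|\colon\mathscr M\to V^+$ such that $|v|=0\iff v=0$, $|v+w|\le|v|+|w|$, $|u\cdot v|=|u||v|$, and the glueing property holds: if $(u_n)_n\in\mathcal P(\mathbf 1_U)$ and $(v_n)_n\subset\mathscr M$ are such that $(|u_n\cdot v_n|)_n$ is order-bounded in $V$ (one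 writes $(u_n,v_n)_n\in\mathrm{Adm}(\mathscr M)$), then there is a (necessarily unique) $v\in\mathscr M$ with $u_n\cdot v=u_n\cdot v_n$ for all $n$, denoted $\sum_{n\in\mathbb N}u_n\cdot v_n$. $\mathscr M$ has the distance $\mathsf d_{\mathscr M}(v,w)=\mathsf d_V(|v-w|,0)$; if it is complete, $\mathscr M$ is a $V$-Banach $U$-module. For $\varnothing\ne S\subset\mathscr M$, $\mathscr G(S)=\{\sum_nu_n\cdot v_n:(u_n)_n\in\mathcal P(\mathbf 1_U),(v_n)_n\subset S,(u_n,v_n)_n\in\mathrm{Adm}(\mathscr M)\}$. *)

(* Defs.v *)
From HB Require Import structures.
From mathcomp Require Import all_boot all_order all_algebra.
From mathcomp Require Import all_classical all_reals all_analysis.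

Set Implicit Arguments.
Unset Strict Implicit.
Unset Printing Implicit Defensive.

Import Order.TTheory GRing.Theory Num.Theory.
Import numFieldNormedType.Exports.

Local Open Scope classical_set_scope.
Local Open Scope ring_scope.

(* Riesz spaces and f-algebras are telescopes and not Hierarchy-Builder
   structures, because Hierarchy Builder rejects a join of [Zmodule] and
   [Lattice] incomparable with [realDomainType]. Their carriers receive the
   library instances below. *)
Record rieszType (R : realType) := RieszType {
  riesz_lmod : lmodType R ;
  riesz_le : rel riesz_lmod ;
  riesz_join : riesz_lmod -> riesz_lmod -> riesz_lmod ;
  riesz_meet : riesz_lmod -> riesz_lmod -> riesz_lmod ;
  riesz_le_refl : reflexive riesz_le ;
  riesz_le_anti : antisymmetric riesz_le ;
  riesz_le_trans : transitive riesz_le ;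
  riesz_meetP : forall u v w,
    riesz_le u (riesz_meet v w) = riesz_le u v && riesz_le u w ;
  riesz_joinP : forall u v w,
    riesz_le (riesz_join u v) w = riesz_le u w && riesz_le v w ;
  riesz_leD2r : forall u v w, riesz_le u v -> riesz_le (u + w) (v + w) ;
  riesz_scale_ge0 : forall (a : R) u,
    0 <= a -> riesz_le 0 u -> riesz_le 0 (a *: u)
}.

Definition riesz_sort (R : realType) (U : rieszType R) : Type := riesz_lmod U.
Coercion riesz_sort : rieszType >-> Sortclass.

HB.instance Definition _ (R : realType) (U : rieszType R) :=
  GRing.Lmodule.copy (riesz_sort U) (riesz_lmod U).
HB.instance Definition _ (R : realType) (U : rieszType R) :=
  Order.Le_isPOrder.Build ring_display (riesz_sort U)
    (@riesz_le_refl R U) (@riesz_le_anti R U) (@riesz_le_trans R U).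
HB.instance Definition _ (R : realType) (U : rieszType R) :=
  Order.POrder_MeetJoin_isLattice.Build ring_display (riesz_sort U)
    (@riesz_meetP R U) (@riesz_joinP R U).

Section RieszNotions.
Context {R : realType}.

Definition rabs {U : rieszType R} (u : U) : U := Order.join u (- u).

Definition rdisjoint {U : rieszType R} (u v : U) : Prop :=
  Order.meet (rabs u) (rabs v) = 0.

Definition disjoint_family {U : rieszType R} {I : Type} (u : I -> U) : Prop :=
  forall i j, i <> j -> rdisjoint (u i) (u j).

Definition order_bounded {U : rieszType R} (A : set U) : Prop :=
  has_lbound A /\ has_ubound A.

Definition solid {U : rieszType R} (A : set U) : Prop :=
  forall u v, A u -> rabs v <= rabs u -> A v.

Definition sigma_complete (U : rieszType R) : Prop :=
  (forall A : set U,
     countable A -> A !=set0 -> has_ubound A -> supremums A !=set0) /\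
  (forall A : set U,
     countable A -> A !=set0 -> has_lbound A -> infimums A !=set0).

Definition riesz_hom {U V : rieszType R} (f : U -> V) : Prop :=
  linear f /\
  (forall u v : U, Order.meet u v = 0 -> Order.meet (f u) (f v) = 0).

Definition sigma_order_continuous {U V : rieszType R} (f : U -> V) : Prop :=
  (forall (u : nat -> U) s, nondecreasing_seq u ->
     supremums (range u) s -> supremums (range (f \o u)) (f s)) /\
  (forall (u : nat -> U) s, nonincreasing_seq u ->
     infimums (range u) s -> infimums (range (f \o u)) (f s)).

End RieszNotions.

(* The null algebra, where 1 = 0, is an f-algebra, whereas [comAlgType] is
   restricted to non-trivial rings: bilinearity is therefore an axiom here. *)
Record fAlgType (R : realType) := FAlgType {
  falg_riesz :> rieszType R ;
  falg_one : falg_riesz ;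
  falg_mul : falg_riesz -> falg_riesz -> falg_riesz ;
  falg_mulA : associative falg_mul ;
  falg_mulC : commutative falg_mul ;
  falg_mul1 : left_id falg_one falg_mul ;
  falg_mulDl : left_distributive falg_mul +%R ;
  falg_scaleAl : forall (a : R) (u v : falg_riesz),
    a *: falg_mul u v = falg_mul (a *: u) v ;
  falg_mul_ge0 : forall u v : falg_riesz,
    0 <= u -> 0 <= v -> 0 <= falg_mul u v ;
  falg_meet_mul : forall u v w : falg_riesz,
    Order.meet u v = 0 -> 0 <= w -> Order.meet (falg_mul u w) v = 0
}.

HB.instance Definition _ (R : realType) (U : fAlgType R) :=
  GRing.Zmodule_isComPzRing.Build (riesz_sort (falg_riesz U))
    (@falg_mulA R U) (@falg_mulC R U) (@falg_mul1 R U) (@falg_mulDl R U).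

Section FAlgebraNotions.
Context {R : realType}.

Definition falg_hom {U V : fAlgType R} (f : U -> V) : Prop :=
  riesz_hom f /\ monoid_morphism f.

Definition idem {U : fAlgType R} : set U := [set u | u * u = u].

Definition fin_partition {U : fAlgType R} (u : U) (n : nat) (e : 'I_n -> U) :=
  [/\ forall i, idem (e i), disjoint_family e & \sum_(i < n) e i = u].

Definition countable_partition {U : fAlgType R} (u : U) (e : nat -> U) :=
  [/\ forall n, idem (e n), disjoint_family e & supremums (range e) u].

Definition simple {U : fAlgType R} : set U :=
  [set x | exists n (a : 'I_n -> R) (e : 'I_n -> U),
     fin_partition 1 e /\ x = \sum_(i < n) a i *: e i].

(* Suprema and infima of monotone sequences in U^+ x U^+ for the product order
   are the componentwise ones, and agree with those taken in U. *)
Definition mul_sigma_order_continuous (U : fAlgType R) : Prop :=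
  (forall (u v : nat -> U) (s t : U),
    (forall n, 0 <= u n) -> (forall n, 0 <= v n) ->
    nondecreasing_seq u -> nondecreasing_seq v ->
    supremums (range u) s -> supremums (range v) t ->
    supremums (range (fun n => u n * v n)) (s * t)) /\
  (forall (u v : nat -> U) (s t : U),
    (forall n, 0 <= u n) -> (forall n, 0 <= v n) ->
    nonincreasing_seq u -> nonincreasing_seq v ->
    infimums (range u) s -> infimums (range v) t ->
    infimums (range (fun n => u n * v n)) (s * t)).

Definition localisable (U : fAlgType R) : Prop :=
  [/\ sigma_complete U, mul_sigma_order_continuous U
    & forall u : U, 0 <= u ->
        exists s : nat -> U,
          [/\ nondecreasing_seq s, forall n, simple (s n) /\ 0 <= s n
            & supremums (range s) u]].

End FAlgebraNotions.

Record distance (R : realType) (T : Type) := Distance {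
  dist :> T -> T -> R ;
  dist_xx : forall x, dist x x = 0 ;
  dist_eq0 : forall x y, dist x y = 0 -> x = y ;
  dist_sym : forall x y, dist x y = dist y x ;
  dist_triangle : forall y x z, dist x z <= dist x y + dist y z
}.

Record distRieszType (R : realType) := DistRieszType {
  dr_riesz :> rieszType R ;
  dr_dist : distance R dr_riesz
}.

HB.instance Definition _ (R : realType) (V : distRieszType R) :=
  isMetric.Build R (riesz_sort (dr_riesz V))
    (dist_xx (dr_dist V)) (@dist_eq0 R V (dr_dist V))
    (dist_sym (dr_dist V)) (dist_triangle (dr_dist V)).

Record distFAlgType (R : realType) := DistFAlgType {
  df_falg :> fAlgType R ;
  df_dist : distance R df_falg
}.

Definition distFAlg_riesz (R : realType) (U : distFAlgType R) :=
  @DistRieszType R U (df_dist U).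
Coercion distFAlg_riesz : distFAlgType >-> distRieszType.
Canonical distFAlg_riesz.

Section MetricNotions.
Context {R : realType}.

(* The axiom of the class [Complete], which also asks for a chosen point. *)
Definition cauchy_complete (T : uniformType) : Prop :=
  forall F : set_system T, ProperFilter F -> cauchy F -> exists x : T, F --> x.

Definition mlipschitz {X Y : metricType R} (f : X -> Y) : Prop :=
  exists L : R, forall x y, mdist (f x) (f y) <= L * mdist x y.

Definition metric_riesz (V : distRieszType R) : Prop :=
  [/\ sigma_complete V, cauchy_complete V,
      forall u : V, mdist u 0 = mdist (rabs u) 0,
      forall u v w : V, mdist (u + w) (v + w) = mdist u v
    & forall u v : V, 0 <= u -> u <= v -> mdist u 0 <= mdist v 0].

Definition metric_falg (U : distFAlgType R) : Prop :=
  [/\ localisable U, metric_riesz U,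
      continuous (fun p : U * U => p.1 * p.2),
      dense (@simple R U)
    & mdist (e *: (1 : U)) 0 @[e --> 0^'+] --> (0 : R)].

End MetricNotions.

(* A solid subspace is presented as a type with its inclusion into the ambient
   space: an injective homomorphism with solid range. A Riesz homomorphism
   preserves joins and meets, so the order on [V] is the one induced by [E]. *)
Record solidRieszSubspace (R : realType) (E V : rieszType R) :=
  SolidRieszSubspace {
    riesz_incl :> V -> E ;
    riesz_incl_inj : injective riesz_incl ;
    riesz_incl_hom : riesz_hom riesz_incl ;
    riesz_incl_solid : solid (range riesz_incl)
  }.

Record solidFSubalgebra (R : realType) (E U : fAlgType R) :=
  SolidFSubalgebra {
    falg_incl :> U -> E ;
    falg_incl_inj : injective falg_incl ;
    falg_incl_hom : falg_hom falg_incl ;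
    falg_incl_solid : solid (range falg_incl)
  }.

(* [mfs_mul] is the multiplication of [E] seen as a map U x V -> V; it is
   determined by [mfs_mulE] since the inclusion of [V] is injective. *)
Record metricFStructure (R : realType) (E : fAlgType R) (U : distFAlgType R)
    (iU : solidFSubalgebra E U) (V : distRieszType R) := MetricFStructure {
  mfs_E_localisable : localisable E ;
  mfs_U_metric : metric_falg U ;
  mfs_V_metric : metric_riesz V ;
  mfs_incl :> solidRieszSubspace E V ;
  mfs_mulUV : [set iU u * mfs_incl v | u in [set: U] & v in [set: V]]
              = range mfs_incl ;
  mfs_mul : U -> V -> V ;
  mfs_mulE : forall u v, mfs_incl (mfs_mul u v) = iU u * mfs_incl v ;
  mfs_mul_continuous : continuous (fun p : U * V => mfs_mul p.1 p.2) ;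
  mfs_glue : forall (u : nat -> U) (e : R), countable_partition 1 u -> 0 < e ->
    exists2 d : R, 0 < d & forall v : nat -> V, (forall n, 0 <= v n) ->
      (\sum_(0 <= n <oo) (mdist (mfs_mul (u n) (v n)) 0)%:E <= d%:E)%E ->
      order_bounded (range (fun n => mfs_mul (u n) (v n))) /\
      exists2 s : V, supremums (range (fun n => mfs_mul (u n) (v n))) s
                   & mdist s 0 <= e
}.

Record dualSystem (R : realType) (E : fAlgType R) (U : distFAlgType R)
    (V W Z : distRieszType R) := DualSystem {
  ds_U :> solidFSubalgebra E U ;
  ds_V : metricFStructure ds_U V ;
  ds_W : metricFStructure ds_U W ;
  ds_Z : metricFStructure ds_U Z ;
  ds_mulVW : [set ds_V v * ds_W w | v in [set: V] & w in [set: W]]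
             = range ds_Z ;
  ds_mul : V -> W -> Z ;
  ds_mulE : forall v w, ds_Z (ds_mul v w) = ds_V v * ds_W w ;
  ds_mul_continuous : continuous (fun p : V * W => ds_mul p.1 p.2)
}.

(* [mfsh_U] and [mfsh_V] are the restrictions of the ambient homomorphism. *)
Record mfsHom (R : realType)
    (E1 : fAlgType R) (U1 : distFAlgType R) (i1 : solidFSubalgebra E1 U1)
    (V1 : distRieszType R) (S1 : metricFStructure i1 V1)
    (E2 : fAlgType R) (U2 : distFAlgType R) (i2 : solidFSubalgebra E2 U2)
    (V2 : distRieszType R) (S2 : metricFStructure i2 V2) := MfsHom {
  mfsh_fun :> E1 -> E2 ;
  mfsh_hom : falg_hom mfsh_fun ;
  mfsh_U : U1 -> U2 ;
  mfsh_UE : forall u, i2 (mfsh_U u) = mfsh_fun (i1 u) ;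
  mfsh_U_hom : falg_hom mfsh_U ;
  mfsh_U_lip : mlipschitz mfsh_U ;
  mfsh_U_cont : sigma_order_continuous mfsh_U ;
  mfsh_V : V1 -> V2 ;
  mfsh_VE : forall v, S2 (mfsh_V v) = mfsh_fun (S1 v) ;
  mfsh_V_hom : riesz_hom mfsh_V ;
  mfsh_V_lip : mlipschitz mfsh_V
}.

Record vNormedModType (R : realType) (E : fAlgType R) (U : distFAlgType R)
    (iU : solidFSubalgebra E U) (V : distRieszType R)
    (S : metricFStructure iU V) := VNormedModType {
  vnm_lmod : lmodType U ;
  vnm_norm : vnm_lmod -> V ;
  vnm_norm_ge0 : forall v, 0 <= vnm_norm v ;
  vnm_norm_eq0 : forall v, vnm_norm v = 0 <-> v = 0 ;
  vnm_ler_normD : forall v w, vnm_norm (v + w) <= vnm_norm v + vnm_norm w ;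
  vnm_normZ : forall (u : U) v,
    vnm_norm (u *: v) = mfs_mul S (rabs u) (vnm_norm v) ;
  vnm_glueing : forall (u : nat -> U) (v : nat -> vnm_lmod),
    countable_partition 1 u ->
    order_bounded (range (fun n => vnm_norm (u n *: v n))) ->
    exists w, forall n, u n *: w = u n *: v n
}.

Section VNormedModules.
Context {R : realType} {E : fAlgType R} {U : distFAlgType R}
        {iU : solidFSubalgebra E U} {V : distRieszType R}
        {S : metricFStructure iU V}.

Definition vnm_sort (M : vNormedModType S) : Type := vnm_lmod M.
Coercion vnm_sort : vNormedModType >-> Sortclass.

HB.instance Definition _ (M : vNormedModType S) :=
  GRing.Lmodule.copy (vnm_sort M) (vnm_lmod M).

Definition vnorm {M : vNormedModType S} (v : M) : V := vnm_norm v.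

Section Distance.
Variable M : vNormedModType S.

Definition vnm_dist (v w : M) : R := mdist (vnorm (v - w)) 0.

Lemma vnorm_eq0 (v : M) : vnorm v = 0 <-> v = 0.
Proof. exact: vnm_norm_eq0. Qed.

Lemma vnormZ (u : U) (v : M) : vnorm (u *: v) = mfs_mul S (rabs u) (vnorm v).
Proof. exact: vnm_normZ. Qed.

Lemma vnormN (v : M) : vnorm (- v) = vnorm v.
Proof.
have absN (u : U) : rabs (- u) = rabs u by rewrite /rabs opprK joinC.
by rewrite -[v in RHS]scale1r -scaleN1r !vnormZ absN.
Qed.

Lemma vnm_dist_xx v : vnm_dist v v = 0.
Proof. by rewrite /vnm_dist subrr (vnorm_eq0 0).2 // mdistxx. Qed.

Lemma vnm_dist_eq0 v w : vnm_dist v w = 0 -> v = w.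
Proof. by move=> /mdist_positivity /vnorm_eq0 /subr0_eq. Qed.

Lemma vnm_dist_sym v w : vnm_dist v w = vnm_dist w v.
Proof. by rewrite /vnm_dist -opprB vnormN. Qed.

Lemma vnm_dist_triangle w v z : vnm_dist v z <= vnm_dist v w + vnm_dist w z.
Proof.
have [_ _ _ distD dist_le] := mfs_V_metric S.
have le_vz : vnorm (v - z) <= vnorm (v - w) + vnorm (w - z).
  by rewrite -[v - z](subrKA w); exact: vnm_ler_normD.
apply: (le_trans (dist_le _ _ (vnm_norm_ge0 _) le_vz)).
apply: (le_trans (metric_triangle _ (vnorm (w - z)) _)).
by rewrite lerD2r -{2}[vnorm (w - z)]add0r distD.
Qed.

End Distance.

HB.instance Definition _ (M : vNormedModType S) :=
  isMetric.Build R (vnm_sort M) (@vnm_dist_xx M) (@vnm_dist_eq0 M)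
    (@vnm_dist_sym M) (@vnm_dist_triangle M).

Definition adm {M : vNormedModType S} (u : nat -> U) (v : nat -> M) : Prop :=
  countable_partition 1 u /\ order_bounded (range (fun n => vnorm (u n *: v n))).

Definition glueings {M : vNormedModType S} (A : set M) : set M :=
  [set w | exists (u : nat -> U) (v : nat -> M),
     [/\ adm u v, forall n, A (v n) & forall n, u n *: w = u n *: v n]].

Definition v_banach (M : vNormedModType S) : Prop := cauchy_complete M.

End VNormedModules.

(* The real vector space structure of a [U]-module. *)
Definition rscale (R : realType) (U : fAlgType R) (M : lmodType U)
  (a : R) (v : M) : M := (a *: (1 : U)) *: v.

Definition real_subspace (R : realType) (U : fAlgType R) (M : lmodType U)
    (A : set M) : Prop :=
  A 0 /\ forall (a : R) v w, A v -> A w -> A (rscale a v + w).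

(* A map defined on a subspace [A] is given as a total map; only its values on
   [A] are constrained. *)
Definition real_linear_on (R : realType) (U1 U2 : fAlgType R)
    (M : lmodType U1) (N : lmodType U2) (A : set M) (T : M -> N) : Prop :=
  forall (a : R) v w, A v -> A w -> T (rscale a v + w) = rscale a (T v) + T w.

(* Main.v *)
Require Import Defs.
From HB Require Import structures.
From mathcomp Require Import all_boot all_order all_algebra.
From mathcomp Require Import all_classical all_reals all_analysis.

Import Order.TTheory GRing.Theory Num.Theory.
Import numFieldNormedType.Exports.

Local Open Scope classical_set_scope.
Local Open Scope ring_scope.

(** A dominated linear map is automatically local: if [u *: x = u *: w] then
    [u *: (x - w) = 0], the norm of [phi u *: T (x - w)] is at most
    [b * phi |u *: (x - w)| = 0], and so [phi u *: T x = phi u *: T w].  Hence on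
    an element [x] glued from pieces [v n] of the subspace along a partition
    [u n] the value [y] of an extension is forced by the equations
    [phi (u n) *: y = phi (u n) *: T (v n)].

    These equations are turned into a relation between the two modules.  A pair
    [(x, y)] is [glued] when the elements [u >= 0] for which some [v] of the
    subspace satisfies [u *: x = u *: v] and [phi u *: y = phi u *: T v] have
    images that jointly annihilate no nonzero positive element of the ambient
    f-algebra ([separating]).  Asking for a separating set and not for a
    partition makes linearity immediate, since products of witnesses for two
    pairs are witnesses for their linear combinations ([glued_linear]).
    The estimate [|y| <= b * phi |x|] holds after multiplication by each
    witness, hence holds ([glued_dominated], by [separating_le]), and the
    glueing property of the target module provides a [y] for every [x] glued
    from elements of the subspace ([glued_total]).

    Continuity of the multiplication by [b] and the Lipschitz property of [phi]
    make [b * phi |x|] small with [x] ([majorant_small]), so that a dominated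
    linear relation is uniformly continuous.  Its closure is still linear and
    dominated, it is functional because domination forces the value [0] at [0],
    and it is total by completeness of the target and density of the domain
    ([rel_closure_total]): this is the extension.

    Any other extension takes glued values on glued elements
    ([dominated_glued]), hence agrees with this one on a dense set.  Finally
    locality, applied to an idempotent [e] and to [1 - e], gives
    [T (e *: x) = phi e *: T x]; real linearity carries this to simple elements
    and their density to all of the algebra ([module_linear]). *)

(** * Riesz spaces *)

Section RieszSpaces.
Context {R : realType}.
Implicit Types U V : rieszType R.

Set Implicit Arguments.
Unset Strict Implicit.

Lemma rleD2r U (w u v : U) : (u + w <= v + w) = (u <= v).
Proof.
apply/idP/idP => [|h]; last exact: riesz_leD2r.
by move=> /(@riesz_leD2r R U _ _ (- w)); rewrite !addrK.
Qed.

Lemma rleD2l U (w u v : U) : (w + u <= w + v) = (u <= v).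
Proof. by rewrite ![w + _]addrC rleD2r. Qed.

Lemma rleD U (u v w z : U) : u <= v -> w <= z -> u + w <= v + z.
Proof.
by move=> uv wz; apply: (@le_trans _ _ (v + w)); rewrite ?rleD2r ?rleD2l. Qed.

Lemma rsubr_ge0 U (u v : U) : (0 <= u - v) = (v <= u).
Proof. by rewrite -[LHS](rleD2r v) add0r subrK. Qed.

Lemma rleN2 U (u v : U) : (- u <= - v) = (v <= u).
Proof. by rewrite -[LHS]rsubr_ge0 opprK addrC rsubr_ge0. Qed.

Lemma raddr_ge0 U (u v : U) : 0 <= u -> 0 <= v -> 0 <= u + v.
Proof. by move=> u0 v0; rewrite -[0]addr0 rleD. Qed.

Lemma rjoinDr U (u v w : U) : Order.join u v + w = Order.join (u + w) (v + w).
Proof.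
apply/le_anti/andP; split; last by rewrite leUx !rleD2r leUl leUr.
rewrite -(rleD2r (- w)) addrK leUx.
by apply/andP; split; rewrite -[_ <= _](rleD2r w) subrK ?leUl ?leUr.
Qed.

Lemma roppJ U (u v : U) : - Order.join u v = Order.meet (- u) (- v).
Proof.
apply/le_anti/andP; split; first by rewrite lexI !rleN2 leUl leUr.
rewrite -[_ <= _]rleN2 opprK leUx.
by apply/andP; split; rewrite -[_ <= _]rleN2 opprK ?leIl ?leIr.
Qed.

Lemma roppI U (u v : U) : - Order.meet u v = Order.join (- u) (- v).
Proof. by rewrite -[RHS]opprK roppJ !opprK. Qed.

Lemma rmeetDr U (u v w : U) : Order.meet u v + w = Order.meet (u + w) (v + w).
Proof.
by apply: oppr_inj; rewrite roppI opprD roppI rjoinDr !opprD.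
Qed.

Definition rpos U (u : U) : U := Order.join u 0.

Lemma rpos_ge0 U (u : U) : 0 <= rpos u. Proof. exact: leUr. Qed.

Lemma ge_rpos U (u : U) : u <= rpos u. Proof. exact: leUl. Qed.

Lemma rpos_le0 U (u : U) : rpos u = 0 -> u <= 0.
Proof. by move=> <-; exact: ge_rpos. Qed.

Lemma rposE U (u : U) : u = rpos u - rpos (- u).
Proof.
by apply/(addIr (rpos (- u))); rewrite subrK addrC /rpos rjoinDr addNr add0r joinC.
Qed.

Lemma rpos_meet0 U (u : U) : Order.meet (rpos u) (rpos (- u)) = 0.
Proof.
have {1}-> : rpos u = u + rpos (- u) by rewrite {2}[u]rposE subrK.
rewrite -[X in Order.meet _ X]add0r -rmeetDr.
by rewrite -{1}[u]opprK -{1}oppr0 -roppJ addNr.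
Qed.

(** A decomposition of a vector into a difference of disjoint elements is its
    decomposition into positive and negative parts. *)
Lemma rpos_subr U (a b : U) : Order.meet a b = 0 -> rpos (a - b) = a.
Proof.
move=> ab0; rewrite /rpos -(subrr a) addrC -[a - a]addrC -rjoinDr -roppI.
by rewrite meetC ab0 oppr0 add0r.
Qed.

Lemma rjoin_posE U (u v : U) : Order.join u v = rpos (u - v) + v.
Proof. by rewrite /rpos rjoinDr subrK add0r. Qed.

Lemma rabs_ge0 U (u : U) : 0 <= rabs u.
Proof.
(* [|u| + |u| >= u + (- u) = 0], then halve. *)
have : 0 <= rabs u + rabs u by rewrite -(subrr u) rleD ?leUl ?leUr.
have h : 0 <= 2^-1 :> R by rewrite invr_ge0.
move=> /(riesz_scale_ge0 h).
by rewrite scalerDr -scalerDl -div1r -splitr scale1r.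
Qed.

Lemma ger0_rabs U (u : U) : 0 <= u -> rabs u = u.
Proof.
rewrite /rabs => u0; apply: join_l; apply: (le_trans _ u0).
by rewrite -oppr0 rleN2.
Qed.

End RieszSpaces.

(** * Homomorphisms of Riesz spaces *)

Section RieszHomomorphisms.
Context {R : realType} {U V : rieszType R}.
Implicit Types f : U -> V.

Set Implicit Arguments.
Unset Strict Implicit.

Lemma riesz_homD f : riesz_hom f -> {morph f : u v / u + v}.
Proof. by case=> lf _ u v; rewrite -[u]scale1r lf !scale1r. Qed.

Lemma riesz_hom0 f : riesz_hom f -> f 0 = 0.
Proof. by move=> hf; apply: (addIr (f 0)); rewrite -riesz_homD // !add0r. Qed.

Lemma riesz_homN f : riesz_hom f -> {morph f : u / - u}.
Proof.
by move=> hf u; apply: (addIr (f u)); rewrite -riesz_homD // !addNr riesz_hom0.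
Qed.

Lemma riesz_homB f : riesz_hom f -> {morph f : u v / u - v}.
Proof. by move=> hf u v; rewrite riesz_homD ?riesz_homN. Qed.

Lemma riesz_homZ f : riesz_hom f -> forall a, {morph f : u / a *: u}.
Proof.
by move=> hf a u; have [lf _] := hf; rewrite -[a *: u]addr0 lf riesz_hom0 ?addr0.
Qed.

(** The images of the positive and negative parts are disjoint, so they are the
    positive and negative parts of the image. *)
Lemma riesz_hom_pos f : riesz_hom f -> {morph f : u / rpos u}.
Proof.
move=> hf u; rewrite {2}[u]rposE riesz_homB //; apply/esym/rpos_subr.
exact: (hf.2 _ _ (rpos_meet0 u)).
Qed.

Lemma riesz_hom_join f : riesz_hom f -> {morph f : u v / Order.join u v}.
Proof.
by move=> hf u v; rewrite !rjoin_posE riesz_homD // riesz_hom_pos // riesz_homB.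
Qed.

Lemma riesz_hom_abs f : riesz_hom f -> {morph f : u / rabs u}.
Proof. by move=> hf u; rewrite /rabs riesz_hom_join // riesz_homN. Qed.

Lemma riesz_hom_homo f : riesz_hom f -> {homo f : u v / u <= v}.
Proof. by move=> hf u v /join_r <-; rewrite riesz_hom_join // leUl. Qed.

Lemma riesz_hom_ge0 f u : riesz_hom f -> 0 <= u -> 0 <= f u.
Proof. by move=> hf u0; rewrite -(riesz_hom0 hf); exact: riesz_hom_homo. Qed.

Lemma riesz_hom_mono f : riesz_hom f -> injective f -> {mono f : u v / u <= v}.
Proof.
move=> hf injf u v; apply/idP/idP => [uv|]; last exact: riesz_hom_homo.
apply/join_idPr/injf; rewrite riesz_hom_join //; exact: join_r.
Qed.

End RieszHomomorphisms.

(** * f-algebras and separating sets *)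

Section FAlgebras.
Context {R : realType} {U : fAlgType R}.
Implicit Types u v w x y : U.

Set Implicit Arguments.
Unset Strict Implicit.

Lemma fmul_ge0 u v : 0 <= u -> 0 <= v -> 0 <= u * v.
Proof. exact: falg_mul_ge0. Qed.

Lemma fscalerAl (a : R) u v : a *: (u * v) = (a *: u) * v.
Proof. exact: falg_scaleAl. Qed.

(** The f-algebra axiom, used in both arguments; all order properties of the
    multiplication by a positive element follow. *)
Lemma fmul_hom u : 0 <= u -> riesz_hom ( *%R u : U -> U).
Proof.
move=> u0; split=> [a x y|x y xy0].
  by rewrite mulrDr [u * (a *: x)]mulrC -fscalerAl [x * u]mulrC.
have h := falg_meet_mul xy0 u0.
rewrite mulrC [u * y]mulrC meetC; apply: falg_meet_mul => //.
by rewrite meetC.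
Qed.

Lemma ler_fmul2l u x y : 0 <= u -> x <= y -> u * x <= u * y.
Proof. by move=> /fmul_hom /riesz_hom_homo; apply. Qed.

Lemma meet0_mul u v : Order.meet u v = 0 -> u * v = 0.
Proof.
move=> uv0; have u0 : 0 <= u by rewrite -uv0 leIl.
have v0 : 0 <= v by rewrite -uv0 leIr.
have vuv0 : Order.meet v (u * v) = 0 by rewrite meetC; exact: falg_meet_mul.
have := falg_meet_mul vuv0 u0.
by rewrite -[falg_mul v u]/(v * u) mulrC meetxx.
Qed.

(** The mixed terms of the square of [rpos u - rpos (- u)] vanish. *)
Lemma fsqr_ge0 u : 0 <= u * u.
Proof.
have pn0 := meet0_mul (rpos_meet0 u).
rewrite [u]rposE mulrBl !mulrBr pn0 [rpos (- u) * _]mulrC pn0 subr0 sub0r opprK.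
by rewrite raddr_ge0 ?fmul_ge0 ?rpos_ge0.
Qed.

Lemma idem_ge0 u : idem u -> 0 <= u.
Proof. by move=> <-; exact: fsqr_ge0. Qed.

(** [separating A] is the order-theoretic form of the assertion that the
    elements of [A] jointly cover [1]: in the algebra of all functions on a
    set, no point is a common zero. *)
Definition separating (A : set U) : Prop :=
  forall x, 0 <= x -> (forall u, A u -> u * x = 0) -> x = 0.

Lemma separating1 : separating [set 1].
Proof. by move=> x _ /(_ 1 erefl); rewrite mul1r. Qed.

Lemma separating_sub (A B : set U) : A `<=` B -> separating A -> separating B.
Proof. by move=> AB sA x x0 h; apply: sA => // u /AB; exact: h. Qed.

Lemma separatingM (A B : set U) : (forall u, B u -> 0 <= u) ->
  separating A -> separating B -> separating [set u * v | u in A & v in B].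
Proof.
move=> B0 sA sB x x0 h; apply: (sB) => // v Bv.
apply: sA => [|u Au]; first by apply: fmul_ge0 => //; exact: B0.
by rewrite mulrA; apply: h; exists u => //; exists v.
Qed.

(** Multiplication by [u >= 0] commutes with positive parts, so the inequality
    says that every [u] in [A] annihilates the positive part of [x - y]. *)
Lemma separating_le (A : set U) x y : separating A -> (forall u, A u -> 0 <= u) ->
  (forall u, A u -> u * x <= u * y) -> x <= y.
Proof.
move=> sA A0 h; rewrite -(rleD2r (- y)) subrr; apply/rpos_le0/sA.
  exact: rpos_ge0.
move=> u Au; rewrite (riesz_hom_pos (fmul_hom (A0 _ Au))) mulrBr /rpos.
by apply: join_r; rewrite -(rleD2r (u * y)) subrK add0r h.
Qed.

End FAlgebras.

(** * Countable suprema and partitions of the unit *)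

Section PartialJoins.
Context {R : realType}.
Implicit Types U V : rieszType R.

Set Implicit Arguments.
Unset Strict Implicit.

Fixpoint partial_join U (u : nat -> U) n : U :=
  if n is m.+1 then Order.join (partial_join u m) (u n) else u 0%N.

Lemma partial_join_homo U (u : nat -> U) : nondecreasing_seq (partial_join u).
Proof. by apply/nondecreasing_seqP => n /=; exact: leUl. Qed.

Lemma le_partial_join U (u : nat -> U) n : u n <= partial_join u n.
Proof. by case: n => [|n] //=; exact: leUr. Qed.

Lemma ubound_partial_join U (u : nat -> U) : ubound (range (partial_join u)) = ubound (range u).
Proof.
apply/seteqP; split=> s su.
  move=> _ [n _ <-]; apply: (le_trans (le_partial_join u n)).
  by apply: su; exists n.
move=> _ [n _ <-]; elim: n => [|n IHn] /=; first by apply: su; exists 0%N.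
by rewrite leUx IHn /=; apply: su; exists n.+1.
Qed.

Lemma supremums_partial_join U (u : nat -> U) :
  supremums (range (partial_join u)) = supremums (range u).
Proof. by rewrite /supremums ubound_partial_join. Qed.

Lemma riesz_hom_partial_join U V (f : U -> V) (u : nat -> U) : riesz_hom f ->
  f \o partial_join u = partial_join (f \o u).
Proof.
move=> hf; apply/funext; elim=> //= n; rewrite /comp => IHn.
by rewrite riesz_hom_join // IHn.
Qed.

(** Sigma-order-continuity speaks of non-decreasing sequences: the family is
    replaced by its partial joins, which a Riesz homomorphism preserves. *)
Lemma sigma_hom_supremums U V (f : U -> V) (u : nat -> U) s :
  riesz_hom f -> sigma_order_continuous f ->
  supremums (range u) s -> supremums (range (f \o u)) (f s).
Proof.
move=> hf [cf _]; rewrite -supremums_partial_join => us.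
rewrite -supremums_partial_join -riesz_hom_partial_join //.
by apply: cf => //; exact: partial_join_homo.
Qed.

End PartialJoins.

Section Partitions.
Context {R : realType} {E : fAlgType R}.

Set Implicit Arguments.
Unset Strict Implicit.

(** If all [u n] annihilate [x] then so do their partial joins, and
    sigma-order-continuity of the multiplication lets [1] annihilate [x]. *)
Lemma supremums1_separating (u : nat -> E) : localisable E ->
  (forall n, 0 <= u n) -> supremums (range u) 1 -> separating (range u).
Proof.
move=> [_ [cm _] _] u0 u1 x x0 ux.
have p0 n : 0 <= partial_join u n := le_trans (u0 n) (le_partial_join u n).
have px n : partial_join u n * x = 0.
  elim: n => [|n IHn] /=; first by apply: ux; exists 0%N.
  apply/le_anti/andP; split; last by rewrite fmul_ge0 // (p0 n.+1).
  have : (partial_join u n + u n.+1) * x = 0.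
    by rewrite mulrDl IHn add0r; apply: ux; exists n.+1.
  (* A join of two positive elements is at most their sum. *)
  move=> <-; rewrite mulrC [_ * x]mulrC ler_fmul2l // leUx.
  by rewrite -{1}[partial_join u n]addr0 -{2}[u n.+1]add0r rleD2l rleD2r u0 p0.
rewrite -supremums_partial_join in u1.
have xx : supremums (range (fun _ : nat => x)) x.
  split=> [_ [_ _ <-] //|s]; apply; by exists 0%N.
have [_] := cm _ _ _ _ p0 (fun=> x0) (partial_join_homo u) (fun _ _ _ => lexx x) u1 xx.
rewrite mul1r => h; apply/le_anti; rewrite x0 andbT.
by apply: h => _ [n _ <-]; rewrite px.
Qed.

(** An upper bound [s] in the ambient algebra may be replaced by the meet of [s]
    and [1], which solidity brings back into the subalgebra. *)
Lemma solid_supremums1 (U : fAlgType R) (i : solidFSubalgebra E U)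
    (u : nat -> U) : (forall n, 0 <= u n) ->
  supremums (range u) 1 -> supremums (range (i \o u)) 1.
Proof.
move=> u0 [u1 lub1]; have [hi [i1 _]] := falg_incl_hom i.
have mono := riesz_hom_mono hi (@falg_incl_inj _ _ _ i).
have iu0 n : 0 <= i (u n) := riesz_hom_ge0 hi (u0 n).
have iu1 n : i (u n) <= 1 by rewrite -i1 mono; apply: u1; exists n.
split=> [_ [n _ <-]|s us]; first exact: iu1.
have le_m n : i (u n) <= Order.meet s 1 by rewrite lexI iu1 andbT us //; exists n.
have m0 : 0 <= Order.meet s 1 := le_trans (iu0 0%N) (le_m 0%N).
have [t _ ti] : range i (Order.meet s 1).
  apply: (@falg_incl_solid _ _ _ i 1); first by exists 1.
  by rewrite !ger0_rabs ?leIr // -i1 (le_trans (iu0 0%N)) // i1.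
apply: (@le_trans _ _ (Order.meet s 1)); last exact: leIl.
rewrite -ti -{1}i1 mono; apply: lub1 => _ [n _ <-].
by rewrite -mono ti.
Qed.

(** The supremum of the partition is computed in the solid subalgebra, whereas the
    elements to be annihilated range over the ambient algebra. *)
Lemma countable_partition_separating (U : fAlgType R)
    (i : solidFSubalgebra E U) (u : nat -> U) :
  localisable E -> countable_partition 1 u -> separating (range (i \o u)).
Proof.
move=> locE; have [hi _] := falg_incl_hom i.
case=> idu _ su; have u0 n : 0 <= u n by apply: idem_ge0; exact: idu.
apply: supremums1_separating => // [n|]; last exact: solid_supremums1.
exact: riesz_hom_ge0.
Qed.

End Partitions.

(** Only sigma-order-continuity transports the condition on the supremum. *)
Lemma countable_partition_hom (R : realType) (U V : fAlgType R) (f : U -> V)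
    (u : nat -> U) : falg_hom f -> sigma_order_continuous f ->
  countable_partition 1 u -> countable_partition 1 (f \o u).
Proof.
move=> [hf [f1 fM]] cf [idu du su]; split.
- by move=> n; rewrite /idem /= -fM idu.
- move=> n m nm; rewrite /rdisjoint /= -!(riesz_hom_abs hf).
  exact: (hf.2 _ _ (du n m nm)).
- by rewrite -f1; exact: sigma_hom_supremums.
Qed.

(** * Metric spaces and metric Riesz spaces *)

Section MetricSpaces.
Context {R : realType}.
Implicit Types X Y Z : metricType R.

Set Implicit Arguments.
Unset Strict Implicit.

Lemma cvg_mdistP X Y (f : X -> Y) (x : X) :
  f x' @[x' --> x] --> f x <->
  (forall e, 0 < e -> exists2 d, 0 < d &
     forall x', mdist x x' < d -> mdist (f x) (f x') < e).
Proof.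
split=> [/cvg_ballP cf e e0|h].
  have /nbhs_ballP[d /= d0 hd] := cf _ e0; exists d => // x' xx'.
  by have := hd x'; rewrite !ballEmdist /=; apply.
apply/cvg_ballP => e e0; have [d d0 hd] := h _ e0.
by apply/nbhs_ballP; exists d => // x'; rewrite /= !ballEmdist; exact: hd.
Qed.

Lemma dense_mdistP X (A : set X) : dense A ->
  forall x e, 0 < e -> exists2 a, A a & mdist x a < e.
Proof.
move=> dA x e e0.
have ne : (ball x e)° !=set0 by exists x; exact: nbhsx_ballx.
have [a [/interior_subset + Aa]] := dA _ ne (open_interior _).
by rewrite ballEmdist; exists a.
Qed.

Lemma continuous_eq_dense X Y (f g : X -> Y) (A : set X) :
  continuous f -> continuous g -> dense A -> (forall a, A a -> f a = g a) ->
  f =1 g.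
Proof.
move=> cf cg dA fg x; apply/mdist_positivity/eqP; rewrite eq_le mdist_ge0 andbT.
apply/ler_addgt0Pl => e e0; rewrite addr0.
have e20 : 0 < e / 2 by rewrite divr_gt0.
have [d1 d10 h1] := (cvg_mdistP f x).1 (cf x) _ e20.
have [d2 d20 h2] := (cvg_mdistP g x).1 (cg x) _ e20.
have d0 : 0 < Num.min d1 d2 by rewrite lt_min d10.
have [a Aa] := dense_mdistP dA x d0; rewrite lt_min => /andP[/h1 fa /h2 ga].
rewrite (splitr e) (le_trans (metric_triangle _ (f a) _)) // lerD //; first exact: ltW.
by rewrite fg // metric_sym ltW.
Qed.

Lemma continuous_pairl X Y Z (f : X -> Y -> Z) (y : Y) :
  continuous (fun p : X * Y => f p.1 p.2) -> continuous (fun x => f x y).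
Proof.
move=> cf x; apply: (@continuous_comp _ _ _ (fun x => (x, y)) (fun p => f p.1 p.2)).
  by apply: cvg_pair => /=; [exact: cvg_id|exact: cvg_cst].
exact: cf.
Qed.

Lemma continuous_pairr X Y Z (f : X -> Y -> Z) (x : X) :
  continuous (fun p : X * Y => f p.1 p.2) -> continuous (fun y => f x y).
Proof.
move=> cf y; apply: (@continuous_comp _ _ _ (fun y => (x, y)) (fun p => f p.1 p.2)).
  by apply: cvg_pair => /=; [exact: cvg_cst|exact: cvg_id].
exact: cf.
Qed.

Lemma mlipschitz_continuous X Y (f : X -> Y) : mlipschitz f -> continuous f.
Proof.
case=> L fL x; apply/cvg_mdistP => e e0.
have L0 : 0 < `|L| + 1 by rewrite ltr_pwDr.
exists (e / (`|L| + 1)) => [|x' xx']; first by rewrite divr_gt0.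
apply: (le_lt_trans (fL _ _)); move: xx'; rewrite ltr_pdivlMr // mulrC.
apply: le_lt_trans; rewrite ler_wpM2r ?mdist_ge0 //.
by rewrite (le_trans (ler_norm L)) // lerDl.
Qed.

End MetricSpaces.

Section MetricRieszSpaces.
Context {R : realType} {V : distRieszType R} (mV : metric_riesz V).
Implicit Types u v : V.

Set Implicit Arguments.
Unset Strict Implicit.

Lemma mdist_subr u v : mdist u v = mdist (u - v) 0.
Proof. by have [_ _ _ + _] := mV => /(_ u v (- v)); rewrite subrr. Qed.

Lemma mdist_rabs u : mdist (rabs u) 0 = mdist u 0.
Proof. by have [_ _ + _ _] := mV. Qed.

Lemma mdist0_le u v : 0 <= u -> u <= v -> mdist u 0 <= mdist v 0.
Proof. by have [_ _ _ _] := mV; apply. Qed.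

Lemma mdist0D u v : mdist (u + v) 0 <= mdist u 0 + mdist v 0.
Proof.
apply: (le_trans (metric_triangle _ v _)).
by rewrite [mdist (u + v) v]mdist_subr addrK.
Qed.

End MetricRieszSpaces.

(** * Normed modules *)

Section NormedModules.
Context {R : realType} {E : fAlgType R} {U : distFAlgType R}
        {iU : solidFSubalgebra E U} {V : distRieszType R}
        {S : metricFStructure iU V} {M : vNormedModType S}.
Implicit Types (u : U) (v w z : M).

Set Implicit Arguments.
Unset Strict Implicit.

Lemma vnorm_ge0 v : 0 <= vnorm v. Proof. exact: vnm_norm_ge0. Qed.

Lemma vnorm0 : vnorm (0 : M) = 0. Proof. exact/vnorm_eq0. Qed.

Lemma ler_vnormD v w : vnorm (v + w) <= vnorm v + vnorm w.
Proof. exact: vnm_ler_normD. Qed.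

Lemma mdistE v w : mdist v w = mdist (vnorm (v - w)) 0.
Proof. by []. Qed.

Lemma vnm_mdistD v w z v' : mdist (v + w) (z + v') <= mdist v z + mdist w v'.
Proof.
apply: (le_trans (metric_triangle _ (z + w) _)).
have -> : mdist (v + w) (z + w) = mdist v z.
  by rewrite !mdistE opprD addrACA subrr addr0.
by rewrite [mdist (z + w) _]mdistE opprD addrACA subrr add0r.
Qed.

Lemma incl_vnormZ u v : S (vnorm (u *: v)) = rabs (iU u) * S (vnorm v).
Proof.
rewrite vnormZ mfs_mulE; congr (_ * _).
by have [hi _] := falg_incl_hom iU; rewrite (riesz_hom_abs hi).
Qed.

Lemma ler_vnormZ_le1 u v : 0 <= u -> u <= 1 -> vnorm (u *: v) <= vnorm v.
Proof.
move=> u0 u1; have hS := riesz_incl_hom S.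
rewrite -(riesz_hom_mono hS (@riesz_incl_inj _ _ _ S)) incl_vnormZ.
have [hi [i1 _]] := falg_incl_hom iU.
rewrite -(riesz_hom_abs hi) ger0_rabs // mulrC -[leRHS]mulr1 ler_fmul2l //.
  exact: riesz_hom_ge0 hS (vnorm_ge0 v).
by rewrite -i1 (riesz_hom_homo hi).
Qed.

(** By the norm identity only the continuity of the multiplication at [(|u|, 0)]
    matters. *)
Lemma vnm_scaler_continuous u : continuous (fun v => u *: v).
Proof.
move=> v; apply/cvg_mdistP => e e0.
have cm := @continuous_pairr _ _ _ _ _ (rabs u) (mfs_mul_continuous (m:=S)).
have m0 : mfs_mul S (rabs u) 0 = 0 by rewrite -vnorm0 -vnormZ scaler0 vnorm0.
have [d d0 hd] := (cvg_mdistP _ _).1 (cm 0) _ e0; exists d => // w vw.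
rewrite mdistE -scalerBr vnormZ metric_sym -m0; apply: hd.
by rewrite metric_sym.
Qed.

Lemma vnm_scalel_continuous v : continuous (fun u => u *: v).
Proof.
have [_ mU _ _ _] := mfs_U_metric S.
move=> u; apply/cvg_mdistP => e e0.
have cm := @continuous_pairl _ _ _ _ _ (vnorm v) (mfs_mul_continuous (m:=S)).
have m0 : mfs_mul S 0 (vnorm v) = 0.
  by rewrite -[X in mfs_mul S X _](ger0_rabs (lexx 0)) -vnormZ scale0r vnorm0.
have [d d0 hd] := (cvg_mdistP _ _).1 (cm 0) _ e0; exists d => // w uw.
rewrite mdistE -scalerBl vnormZ metric_sym -m0; apply: hd.
by rewrite metric_sym mdist_rabs // -mdist_subr.
Qed.

Lemma rscaleN1 v : rscale (-1) v = - v.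
Proof. by rewrite /rscale scaleN1r scaleN1r. Qed.

Lemma rscale1 v : rscale 1 v = v.
Proof. by rewrite /rscale scale1r scale1r. Qed.

Lemma rscalerA u a v : u *: rscale a v = rscale a (u *: v).
Proof. by rewrite /rscale !scalerA mulrC. Qed.

End NormedModules.

(** * Dominated pairs and their closure *)

Section DominatedExtension.
Context {R : realType}
  {E1 : fAlgType R} {U1 : distFAlgType R} {V1 : distRieszType R}
  {i1 : solidFSubalgebra E1 U1} {S1 : metricFStructure i1 V1}
  {E2 : fAlgType R} {U2 : distFAlgType R} {V2 W2 Z2 : distRieszType R}
  {D2 : dualSystem E2 U2 V2 W2 Z2}
  {phi : mfsHom S1 (ds_V D2)}
  {M : vNormedModType S1} {N : vNormedModType (ds_Z D2)} {b : W2}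
  (b_ge0 : 0 <= b).
Implicit Types (x w : M) (y : N) (u : U1).

Set Implicit Arguments.
Unset Strict Implicit.

Let phi_hom : riesz_hom phi := (mfsh_hom phi).1.
Let Z2_metric : metric_riesz Z2 := mfs_V_metric (ds_Z D2).
Let inclZ_hom : riesz_hom (ds_Z D2) := riesz_incl_hom (ds_Z D2).
Let inclZ_mono : {mono ds_Z D2 : u v / u <= v} :=
  riesz_hom_mono inclZ_hom (@riesz_incl_inj _ _ _ (ds_Z D2)).
Let inclW_b_ge0 : 0 <= ds_W D2 b := riesz_hom_ge0 (riesz_incl_hom (ds_W D2)) b_ge0.

Definition dominated x y : Prop :=
  ds_Z D2 (vnorm y) <= ds_W D2 b * phi (S1 (vnorm x)).

Lemma phi_vnormZ u x :
  phi (S1 (vnorm (u *: x))) = rabs (phi (i1 u)) * phi (S1 (vnorm x)).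
Proof.
have [_ [_ phiM]] := mfsh_hom phi.
by rewrite incl_vnormZ phiM (riesz_hom_abs phi_hom).
Qed.

Lemma inclZ_vnormZ u y :
  ds_Z D2 (vnorm (mfsh_U phi u *: y)) = rabs (phi (i1 u)) * ds_Z D2 (vnorm y).
Proof. by rewrite incl_vnormZ mfsh_UE. Qed.

Lemma dominatedZ u x y : dominated x y -> dominated (u *: x) (mfsh_U phi u *: y).
Proof.
rewrite /dominated phi_vnormZ inclZ_vnormZ mulrCA => h.
by apply: ler_fmul2l => //; exact: rabs_ge0.
Qed.

Lemma dominated0 y : dominated 0 y -> y = 0.
Proof.
rewrite /dominated vnorm0 (riesz_hom0 (riesz_incl_hom S1)) (riesz_hom0 phi_hom).
rewrite mulr0 -(riesz_hom0 inclZ_hom) inclZ_mono => h.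
by apply/vnorm_eq0/le_anti; rewrite h vnorm_ge0.
Qed.

(** The bound on the norm of the image of [x], as an element of the value
    space [Z2] and not merely of the ambient algebra: this is what makes its
    distance to [0] meaningful. *)
Definition majorant x : Z2 := ds_mul D2 (mfsh_V phi (vnorm x)) b.

Lemma majorantE x : ds_Z D2 (majorant x) = ds_W D2 b * phi (S1 (vnorm x)).
Proof. by rewrite ds_mulE mfsh_VE mulrC. Qed.

Lemma dominatedP x y : dominated x y <-> vnorm y <= majorant x.
Proof. by rewrite /dominated -majorantE inclZ_mono. Qed.

Lemma majorant_ge0 x : 0 <= majorant x.
Proof.
rewrite -inclZ_mono majorantE (riesz_hom0 inclZ_hom) fmul_ge0 //.
apply: riesz_hom_ge0 => //; apply: riesz_hom_ge0; last exact: vnorm_ge0.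
exact: riesz_incl_hom.
Qed.

Lemma majorantN x : majorant (- x) = majorant x.
Proof. by rewrite /majorant vnormN. Qed.

Lemma ler_majorantD x x' : majorant (x + x') <= majorant x + majorant x'.
Proof.
rewrite -inclZ_mono (riesz_homD inclZ_hom) !majorantE -mulrDr -(riesz_homD phi_hom).
rewrite -(riesz_homD (riesz_incl_hom S1)); apply: ler_fmul2l => //.
apply: riesz_hom_homo => //; apply: riesz_hom_homo; last exact: ler_vnormD.
exact: riesz_incl_hom.
Qed.

Lemma majorant_small e : 0 < e ->
  exists2 d, 0 < d & forall x, mdist x 0 < d -> mdist (majorant x) 0 < e.
Proof.
move=> e0.
have cphi : continuous (mfsh_V phi) := mlipschitz_continuous (mfsh_V_lip phi).
have cm := @continuous_pairl _ _ _ _ _ b (ds_mul_continuous (d:=D2)).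
have m0 : ds_mul D2 (mfsh_V phi 0) b = 0.
  have := majorantE 0; rewrite /majorant vnorm0 (riesz_hom0 (riesz_incl_hom S1)).
  rewrite (riesz_hom0 phi_hom) mulr0 -(riesz_hom0 inclZ_hom).
  exact: riesz_incl_inj.
have [d1 d10 h1] := (cvg_mdistP _ _).1 (cm (mfsh_V phi 0)) _ e0.
have [d d0 h] := (cvg_mdistP _ _).1 (cphi 0) _ d10; exists d => // x x0.
rewrite metric_sym -m0; apply/h1/h; rewrite metric_sym; move: x0.
by rewrite mdistE subr0.
Qed.

Lemma dominated_mdist x y : dominated x y -> mdist y 0 <= mdist (majorant x) 0.
Proof.
move=> /dominatedP xy; rewrite mdistE subr0.
by apply: mdist0_le xy => //; exact: vnorm_ge0.
Qed.

(** A linear relation consisting of dominated pairs is the graph of a uniformly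
    continuous map; when its domain is dense and [N] is complete, its closure
    is the graph of a dominated linear map defined everywhere. *)
Section ClosureOfARelation.
Variable G : M -> N -> Prop.
Hypothesis G_linear : forall a x x' y y', G x y -> G x' y' ->
  G (rscale a x + x') (rscale a y + y').
Hypothesis G_dominated : forall x y, G x y -> dominated x y.

Definition rel_closure x y : Prop := forall e, 0 < e ->
  exists x' y', [/\ G x' y', mdist x x' < e & mdist y y' < e].

Lemma rel_closure_sub x y : G x y -> rel_closure x y.
Proof. by move=> Gxy e e0; exists x, y; split=> //; rewrite mdistxx. Qed.

Lemma rel_closure_linear a x x' y y' : rel_closure x y -> rel_closure x' y' ->
  rel_closure (rscale a x + x') (rscale a y + y').
Proof.
move=> cxy cxy' e e0; have e20 : 0 < e / 2 by rewrite divr_gt0.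
have [d1 d10 h1] :=
  (cvg_mdistP _ _).1 (@vnm_scaler_continuous _ _ _ _ _ _ M (a *: (1 : U1)) x) _ e20.
have [d2 d20 h2] :=
  (cvg_mdistP _ _).1 (@vnm_scaler_continuous _ _ _ _ _ _ N (a *: (1 : U2)) y) _ e20.
have d0 : 0 < Num.min d1 d2 by rewrite lt_min d10.
have [p [q [Gpq]]] := cxy _ d0.
rewrite !lt_min => /andP[/h1 xp _] /andP[_ /h2 yq].
have [p' [q' [Gpq' xp' yq']]] := cxy' _ e20.
exists (rscale a p + p'), (rscale a q + q'); split; first exact: G_linear.
- by apply: (le_lt_trans (vnm_mdistD _ _ _ _)); rewrite (splitr e) ltrD.
- by apply: (le_lt_trans (vnm_mdistD _ _ _ _)); rewrite (splitr e) ltrD.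
Qed.

(** Passing to [(x', y')] near [(x, y)] perturbs [vnorm y - majorant x] by at most
    [vnorm (y - y') + majorant (x - x')], so its positive part is at distance
    [0] from [0]. *)
Lemma rel_closure_dominated x y : rel_closure x y -> dominated x y.
Proof.
move=> cxy; apply/dominatedP; rewrite -(rleD2r (- majorant x)) subrr.
apply/rpos_le0/mdist_positivity/eqP; rewrite eq_le mdist_ge0 andbT.
apply/ler_addgt0Pl => e e0; rewrite addr0.
have e20 : 0 < e / 2 by rewrite divr_gt0.
have [d d0 small] := majorant_small e20.
have m0 : 0 < Num.min d (e / 2) by rewrite lt_min d0.
have [x' [y' [Gxy]]] := cxy _ m0.
rewrite !lt_min => /andP[xx' _] /andP[_ yy'].
pose r := vnorm (y - y') + majorant (x - x').
have r0 : 0 <= r by rewrite raddr_ge0 ?vnorm_ge0 ?majorant_ge0.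
have le_r : rpos (vnorm y - majorant x) <= r.
  rewrite /rpos leUx r0 andbT -(rleD2r (majorant x)) subrK -addrA.
  have := ler_vnormD (y - y') y'; rewrite subrK => /le_trans; apply.
  rewrite rleD2l; apply: (le_trans ((dominatedP _ _).1 (G_dominated Gxy))).
  have := ler_majorantD (- (x - x')) x.
  by rewrite majorantN opprB subrK.
apply: (le_trans (mdist0_le Z2_metric (rpos_ge0 _) le_r)).
apply: (le_trans (mdist0D Z2_metric _ _)); rewrite (splitr e) lerD //.
  by rewrite -mdistE ltW.
apply/ltW/small; by rewrite mdistE subr0 -mdistE.
Qed.

(** The difference of two values at [x] is a value at [0]. *)
Lemma rel_closure_fun x y y' : rel_closure x y -> rel_closure x y' -> y = y'.
Proof.
move=> cxy cxy'; have := rel_closure_linear (-1) cxy cxy'.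
rewrite !rscaleN1 addNr => /rel_closure_dominated /dominated0 /eqP.
by rewrite addrC subr_eq0 => /eqP.
Qed.

(** The values of [G] near [x] generate a Cauchy filter, because differences of
    pairs in [G] are in [G] and are dominated. *)
Lemma rel_closure_total : v_banach N -> dense [set x | exists y, G x y] ->
  forall x, exists y, rel_closure x y.
Proof.
move=> cN dG x.
pose near_values d := [set y | exists2 x', mdist x x' < d & G x' y].
pose F : set_system N := filter_from [set d | 0 < d] near_values.
have FF : Filter F.
  apply: filter_from_filter; first by exists 1; exact: ltr01.
  move=> d d' d0 d'0; exists (Num.min d d'); first by rewrite /= lt_min d0.
  by move=> y [x' + Gxy]; rewrite lt_min => /andP[? ?]; split; exists x'.
have PF : ProperFilter F.
  apply: filter_from_proper => d d0.
  have [x' [y Gxy] xx'] := dense_mdistP dG x d0.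
  by exists y, x'.
have Fcauchy : cauchy F.
  apply/cauchy_exP => e e0.
  have [d d0 small] := majorant_small e0.
  have d20 : 0 < d / 2 by rewrite divr_gt0.
  have [p [q Gpq] xp] := dense_mdistP dG x d20.
  exists q; exists (d / 2) => // y [x' xx' Gxy]; rewrite ballEmdist /=.
  have := G_dominated (G_linear (-1) Gxy Gpq).
  rewrite !rscaleN1 ![- _ + _]addrC => /dominated_mdist.
  rewrite mdistE subr0 -mdistE => /le_lt_trans; apply.
  apply: small; rewrite mdistE subr0 -mdistE metric_sym.
  apply: (le_lt_trans (metric_triangle _ x _)); rewrite (splitr d) ltrD //.
  by rewrite metric_sym.
have [y Fy] := cN F PF Fcauchy; exists y => e e0.
have [d /= d0 hd] : F (ball y e) by apply: Fy; exact: nbhsx_ballx.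
have m0 : 0 < Num.min d e by rewrite lt_min d0.
have [x' [y' Gxy]] := dense_mdistP dG x m0; rewrite lt_min => /andP[xd xe].
exists x', y'; split=> //; have : ball y e y' by apply: hd; exists x'.
by rewrite ballEmdist.
Qed.

End ClosureOfARelation.

(** * Dominated linear maps *)

Let phiU_hom : falg_hom (mfsh_U phi) := mfsh_U_hom phi.

Let phi_ge0 u : 0 <= u -> 0 <= phi (i1 u).
Proof.
move=> u0; apply: riesz_hom_ge0 => //; apply: riesz_hom_ge0 => //.
exact: (falg_incl_hom i1).1.
Qed.

Let phiM u u' : phi (i1 (u * u')) = phi (i1 u) * phi (i1 u').
Proof.
have [_ [_ iM]] := falg_incl_hom i1; have [_ [_ pM]] := mfsh_hom phi.
by rewrite iM pM.
Qed.

Lemma phi_partition_separating (u : nat -> U1) : countable_partition 1 u ->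
  separating (range (fun n => phi (i1 (u n)))).
Proof.
move=> pu; have -> : (fun n => phi (i1 (u n))) = ds_U D2 \o (mfsh_U phi \o u).
  by apply/funext => n /=; rewrite mfsh_UE.
apply: countable_partition_separating (mfs_E_localisable (ds_Z D2)) _.
exact: countable_partition_hom phiU_hom (mfsh_U_cont phi) pu.
Qed.

Section DominatedLinearMaps.
Variable T : M -> N.
Hypothesis T_linear : real_linear_on [set: M] T.
Hypothesis T_dominated : forall x, dominated x (T x).

Lemma linmapD : {morph T : x w / x + w}.
Proof. by move=> x w; have := @T_linear 1 x w I I; rewrite !rscale1. Qed.

Lemma linmap0 : T 0 = 0.
Proof. by apply: (addIr (T 0)); rewrite -linmapD !add0r. Qed.

Lemma linmapZ a : {morph T : x / rscale a x}.
Proof. by move=> x; have := @T_linear a x 0 I I; rewrite linmap0 !addr0. Qed.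

Lemma linmapB : {morph T : x w / x - w}.
Proof.
move=> x w; rewrite linmapD; congr (_ + _); apply: (addIr (T w)).
by rewrite -linmapD !addNr linmap0.
Qed.

(** Domination localises: [u *: T (x - w)] is dominated by [u *: (x - w) = 0]. *)
Lemma dominated_local u x w : u *: x = u *: w ->
  mfsh_U phi u *: T x = mfsh_U phi u *: T w.
Proof.
move=> /eqP; rewrite -subr_eq0 -scalerBr => /eqP uxw0; apply/subr0_eq.
rewrite -scalerBr -linmapB; apply: dominated0.
by rewrite -uxw0; exact: dominatedZ (T_dominated _).
Qed.

Lemma dominated_continuous : continuous T.
Proof.
move=> x; apply/cvg_mdistP => e e0.
have [d d0 small] := majorant_small e0.
exists d => // w xw.
have := dominated_mdist (T_dominated (x - w)).
rewrite linmapB mdistE subr0 -mdistE => /le_lt_trans; apply; apply: small.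
by rewrite mdistE subr0 -mdistE.
Qed.

(** Locality for [u] and for [1 - u]: [u *: x] agrees with [x] on [u] and with [0]
    on [1 - u]. *)
Lemma idem_linear u x : idem u -> T (u *: x) = mfsh_U phi u *: T x.
Proof.
move=> uu; have [_ [p1 _]] := phiU_hom.
have e1 : mfsh_U phi u *: T (u *: x) = mfsh_U phi u *: T x.
  by apply: dominated_local; rewrite scalerA uu.
have e2 : mfsh_U phi (1 - u) *: T (u *: x) = mfsh_U phi (1 - u) *: T 0.
  by apply: dominated_local; rewrite scalerA mulrBl mul1r uu subrr scale0r scaler0.
rewrite linmap0 scaler0 in e2.
rewrite -e1; apply/subr0_eq; rewrite -{1}[T (u *: x)]scale1r -scalerBl.
by rewrite -p1 -(riesz_homB phiU_hom.1).
Qed.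

Lemma simple_linear u x : simple u -> T (u *: x) = mfsh_U phi u *: T x.
Proof.
move=> [n [a [e [[ide _ _] ->]]]].
have hU := phiU_hom.1.
have scE (U : distFAlgType R) (Q : lmodType U) (c : R) (p : U) (q : Q) :
    (c *: p) *: q = rscale c (p *: q).
  by rewrite /rscale scalerA -fscalerAl mul1r.
rewrite scaler_suml (big_morph T linmapD linmap0).
rewrite (big_morph (mfsh_U phi) (riesz_homD hU) (riesz_hom0 hU)) scaler_suml.
apply: eq_bigr => i _.
by rewrite scE linmapZ idem_linear // (riesz_homZ hU) scE.
Qed.

(** Both sides are continuous in [u], so that the case of simple elements, which
    are dense, suffices. *)
Lemma module_linear u x : T (u *: x) = mfsh_U phi u *: T x.
Proof.
have [_ _ _ dS _] := mfs_U_metric S1.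
apply: (continuous_eq_dense (f := fun u => T (u *: x))
  (g := fun u => mfsh_U phi u *: T x) _ _ dS) => [v|v|v sv].
- apply: (@continuous_comp _ _ _ (fun u : U1 => u *: x) T).
    exact: vnm_scalel_continuous.
  exact: dominated_continuous.
- apply: (@continuous_comp _ _ _ (mfsh_U phi) (fun u : U2 => u *: T x)).
    exact: (mlipschitz_continuous (mfsh_U_lip phi)).
  exact: vnm_scalel_continuous.
- exact: simple_linear.
Qed.

End DominatedLinearMaps.

(** * Glueing along separating sets *)

Section Glueing.
Variables (VV : set M) (T : M -> N).
Hypothesis VV_subspace : real_subspace VV.
Hypothesis T_linear : real_linear_on VV T.
Hypothesis T_dominated : forall v, VV v -> dominated v (T v).

(** The pieces on which the pair [(x, y)] looks like a pair [(v, T v)]; [v] may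
    vary with the piece. *)
Definition witnesses x y : set U1 :=
  [set u : U1 | 0 <= u /\ exists v, [/\ VV v, u *: x = u *: v
                               & mfsh_U phi u *: y = mfsh_U phi u *: T v]].

Definition glued x y : Prop :=
  separating [set phi (i1 u) | u in witnesses x y].

Lemma glued_sub v : VV v -> glued v (T v).
Proof.
move=> Vv; apply: separating_sub separating1 => _ ->.
exists 1; last by have [_ [-> _]] := falg_incl_hom i1; have [_ [-> _]] := mfsh_hom phi.
by split; [rewrite -(mul1r 1); exact: fsqr_ge0 | exists v].
Qed.

(** Products of witnesses for the two pairs are witnesses for the combination,
    and they play the part of a common refinement of two partitions. *)
Lemma glued_linear a x x' y y' : glued x y -> glued x' y' ->
  glued (rscale a x + x') (rscale a y + y').
Proof.
move=> g g'; have [_ [_ pM]] := phiU_hom.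
apply: separating_sub (separatingM _ g g'); last first.
  by move=> _ [u [u0 _] <-]; exact: phi_ge0.
move=> _ [_ [u [u0 [v [Vv uv fv]]] <-] [_ [u' [u'0 [v' [Vv' uv' fv']]] <-] <-]].
exists (u * u'); last exact: phiM.
split; first exact: fmul_ge0.
exists (rscale a v + v'); split; first exact: VV_subspace.2.
- rewrite !scalerDr !rscalerA; congr (rscale a _ + _); last first.
    by rewrite -!scalerA uv'.
  by rewrite mulrC -!scalerA uv.
- rewrite T_linear // !scalerDr !rscalerA pM; congr (rscale a _ + _); last first.
    by rewrite -!scalerA fv'.
  by rewrite mulrC -!scalerA fv.
Qed.

(** Multiplied by a witness, the pair [(x, y)] becomes a multiple of [(v, T v)],
    for which the bound is known. *)
Lemma glued_dominated x y : glued x y -> dominated x y.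
Proof.
move=> g; apply: (separating_le g) => [_ [u [u0 _] <-]|_ [u [u0 [v [Vv uv fv]]] <-]].
  exact: phi_ge0.
have := dominatedZ u (T_dominated Vv).
rewrite -fv -uv /dominated phi_vnormZ inclZ_vnormZ ger0_rabs ?phi_ge0 //.
by rewrite mulrCA.
Qed.

(** By locality, the pieces along which [x] is glued are witnesses for every
    dominated linear extension; this is what makes the extension unique. *)
Lemma dominated_glued (Tbar : M -> N) x : real_linear_on [set: M] Tbar ->
  (forall x, dominated x (Tbar x)) -> (forall v, VV v -> Tbar v = T v) ->
  glueings VV x -> glued x (Tbar x).
Proof.
move=> lT dT eT [u [v [[pu _] Vv uv]]].
apply: separating_sub (phi_partition_separating pu) => _ [n _ <-].
exists (u n) => //; split.
  by apply: idem_ge0; have [+ _ _] := pu.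
exists (v n); split=> //; rewrite -eT //.
exact: dominated_local.
Qed.

(** The glueing property of [N] produces the value: the pieces [T (v n)] are
    admissible because on the n-th piece they are dominated by [x] itself. *)
Lemma glued_total x : glueings VV x -> exists y, glued x y.
Proof.
move=> [u [v [[pu _] Vv uv]]].
have pu2 := countable_partition_hom phiU_hom (mfsh_U_cont phi) pu.
have u0 n : 0 <= u n by apply: idem_ge0; have [+ _ _] := pu.
have bounded : order_bounded (range (fun n => vnorm (mfsh_U phi (u n) *: T (v n)))).
  split; first by exists 0 => _ [n _ <-]; exact: vnorm_ge0.
  exists (majorant x) => _ [n _ <-].
  apply/dominatedP => //.
  have := dominatedZ (u n) (T_dominated (Vv n)).
  rewrite /dominated -uv => /le_trans; apply; apply: ler_fmul2l.
    exact: riesz_hom_ge0 (riesz_incl_hom (ds_W D2)) b_ge0.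
  apply: riesz_hom_homo => //; apply: riesz_hom_homo; first exact: riesz_incl_hom.
  apply: ler_vnormZ_le1 => //; have [_ _ [ub1 _]] := pu.
  by apply: ub1; exists n.
have [y hy] := vnm_glueing pu2 bounded; exists y.
apply: separating_sub (phi_partition_separating pu) => _ [n _ <-].
exists (u n) => //; split=> //; exists (v n); split=> //.
exact: hy.
Qed.

End Glueing.
End DominatedExtension.

(** * The extension theorem *)

Theorem theorem3p16 (R : realType)
    (E1 : fAlgType R) (U1 : distFAlgType R) (V1 : distRieszType R)
    (i1 : solidFSubalgebra E1 U1) (S1 : metricFStructure i1 V1)
    (E2 : fAlgType R) (U2 : distFAlgType R) (V2 W2 Z2 : distRieszType R)
    (D2 : dualSystem E2 U2 V2 W2 Z2)
    (phi : mfsHom S1 (ds_V D2))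
    (M : vNormedModType S1) (N : vNormedModType (ds_Z D2))
    (N_banach : v_banach N)
    (VV : set M) (T : M -> N) (b : W2)
    (VV_subspace : real_subspace VV)
    (VV_dense : dense (glueings VV))
    (T_linear : real_linear_on VV T)
    (b_ge0 : 0 <= b)
    (T_bound : forall v, VV v ->
       ds_Z D2 (vnorm (T v)) <= ds_W D2 b * phi (S1 (vnorm v))) :
  let extension (Tbar : M -> N) :=
    [/\ real_linear_on [set: M] Tbar,
        forall v, VV v -> Tbar v = T v
      & forall v, ds_Z D2 (vnorm (Tbar v)) <= ds_W D2 b * phi (S1 (vnorm v))] in
  (exists! Tbar : M -> N, extension Tbar) /\
  (forall Tbar : M -> N, extension Tbar ->
     continuous Tbar /\
     forall (u : U1) (v : M), Tbar (u *: v) = mfsh_U phi u *: Tbar v).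
Proof.
move=> extension.
have G_linear := glued_linear (phi := phi) VV_subspace T_linear.
have G_dominated := glued_dominated (phi := phi) T_bound.
have cl_total : forall x, exists y, rel_closure (glued (phi := phi) VV T) x y.
  apply: (rel_closure_total G_linear G_dominated) => //.
  move=> O O0 oO; have [x [Ox Gx]] := VV_dense O O0 oO.
  by exists x; split=> //; exact: (glued_total b_ge0 T_bound Gx).
have cl_fun := rel_closure_fun b_ge0 G_linear G_dominated.
have cl_linear := rel_closure_linear G_linear.
have [Tbar clT] := choice cl_total.
have extT : extension Tbar.
  split.
  - by move=> a x w _ _; apply: cl_fun (clT _) _; exact: cl_linear.
  - by move=> v Vv; apply: cl_fun (clT _) _; apply/rel_closure_sub/glued_sub.
  - by move=> v; exact: (rel_closure_dominated b_ge0 G_dominated (clT v)).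
have ext_continuous T' : extension T' -> continuous T'.
  by case=> lT _ dT; exact: (dominated_continuous lT dT).
split; last first.
  move=> T' eT; split; first exact: ext_continuous.
  by case: eT => lT _ dT u v; exact: (module_linear lT dT).
exists Tbar; split=> // T' eT'; apply/funext.
apply: (continuous_eq_dense (ext_continuous _ extT) (ext_continuous _ eT') VV_dense).
move=> x Gx; apply: cl_fun (clT x) _; apply: rel_closure_sub.
by case: eT' => lT' eT' dT'; exact: (dominated_glued lT' dT' eT').
Qed.
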